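(* Let $(\mathcal A_n)_{n\ge1}$ be a sequence of cones with $\mathcal A_n\subseteq\mathcal S_n$ for every $n$, such that $\mathcal A_n\subseteq\mathcal C_n$ for all $n$ and the sequence has the product property. For a graph $G$ with vertex set $\{1,\dots,n\}$, let $f(G)$ be the optimal value of the problem $$\begin{aligned}\min\quad & \lambda\\ \text{s.t.}\quad & Y-J_n\in\mathcal A_n,\\ & Y_{ii}=\lambda\quad\text{for all } i=1,\dots,n,\\ & Y_{ij}=0\quad\text{for all } i,j \text{ with } i\not\sim_G j,\\ & Y\in\mathcal S_n,\end{aligned}$$ over $\lambda\in\mathbb R$ and $Y$. Then $\Theta(G)\le f(G)$ for every graph $G$, where $\Theta(G)$ is the Shannon capacity of $G$.
   Context: Graphs are finite, undirected, simple, with at least one vertex; the vertices of a graph with $n$ vertices are labelled $1,\dots,n$. For vertices $i,j$ of $G$, $i\sim_G j$ means $i=j$ or $(i,j)$ is an edge of $G$; $i\not\sim_G j$ is the negation. $\alpha(G)$ is the independence number (size of a maximum independent set). The strong product $G\boxtimes H$ has vertex set $V(G)\times V(H)$, with $(i,j)\sim_{G\boxtimes H}(k,l)$ if and only if $i\sim_G k$ and $j\sim_H l$. $G^k$ denotes the strong product of $G$ with itself $k$ times, and the Shannon capacity is $\Theta(G)=\sup_{k\ge1}\sqrt[k]{\alpha(G^k)}$. $\mathcal S_n$ is the set of real symmetric $n\times n$ matrices; $\mathcal C_n\subseteq\mathcal S_n$ is the cone of copositive matrices, i.e. all $Q\in\mathcal S_n$ with $x^TQx\ge 0$ for every entrywise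 nonnegative $x\in\mathbb R^n$; $J_n$ is the $n\times n$ all-ones matrix. A cone in $\mathcal S_n$ is a subset closed under multiplication by positive real scalars (convexity or closedness is not required). The optimal value of the minimization problem is the infimum of $\lambda$ over feasible pairs $(\lambda,Y)$, equal to $+\infty$ if there is no feasible pair. For $Q\in\mathcal S_n$ and $R\in\mathcal S_m$ define $$Q\odot R=(Q+J_n)\otimes(R+J_m)-J_{nm},$$ where $\otimes$ is the Kronecker product: indexing rows by pairs $(i,j)$ and columns by pairs $(k,l)$ in lexicographic order, $(M\otimes N)_{(i,j)(k,l)}=M_{ik}N_{jl}$. A sequence of cones $\mathcal A_n\subseteq\mathcal S_n$ ($n\ge1$) has the product property if for all $n,m$ and all $Q\in\mathcal A_n$, $R\in\mathcal A_m$, one has $Q\odot R\in\mathcal A_{nm}$. *)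

(* Defs.v *)
From mathcomp Require Import all_boot all_order all_algebra.
From mathcomp Require Import sesquilinear mxtens.
From mathcomp Require Import all_classical all_reals all_analysis.

Set Implicit Arguments.
Unset Strict Implicit.
Unset Printing Implicit Defensive.

Import Order.TTheory GRing.Theory Num.Theory.
Local Open Scope classical_set_scope.
Local Open Scope ring_scope.

Record sgraph (T : finType) := SGraph {
  edge : rel T;
  edge_sym : symmetric edge;
  edge_irr : irreflexive edge
}.

Definition adj (T : finType) (G : sgraph T) : rel T :=
  fun i j => (i == j) || edge G i j.

Definition independent (T : finType) (G : sgraph T) (S : {set T}) : bool :=
  [forall i in S, forall j in S, ~~ edge G i j].

Definition alpha (T : finType) (G : sgraph T) : nat :=
  (\max_(S : {set T} | independent G S) #|S|)%N.

Section StrongProduct.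
Variables (T U : finType) (G : sgraph T) (H : sgraph U).

Definition strong_edge : rel (T * U) :=
  fun p q => [&& p != q, adj G p.1 q.1 & adj H p.2 q.2].

Lemma strong_edge_sym : symmetric strong_edge.
Proof.
move=> p q; rewrite /strong_edge /adj eq_sym.
by rewrite (eq_sym p.1) (eq_sym p.2) (edge_sym G) (edge_sym H).
Qed.

Lemma strong_edge_irr : irreflexive strong_edge.
Proof. by move=> p; rewrite /strong_edge eqxx. Qed.

Definition strong_prod : sgraph (T * U)%type :=
  SGraph strong_edge_sym strong_edge_irr.

Lemma adj_strong_prod (p q : T * U) :
  adj strong_prod p q = adj G p.1 q.1 && adj H p.2 q.2.
Proof.
rewrite {1}/adj /= /strong_edge.
by case: eqVneq => //= ->; rewrite /adj !eqxx.
Qed.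

End StrongProduct.

(* Strong powers are indexed so that strong_powS G k is the (k+1)-st power:
   strong_powS G 0 is G itself. *)
Fixpoint powS_vertex (T : finType) (k : nat) : finType :=
  if k is k'.+1 then (T * powS_vertex T k')%type else T.

Fixpoint strong_powS (T : finType) (G : sgraph T) (k : nat) :
    sgraph (powS_vertex T k) :=
  if k is k'.+1 then strong_prod G (strong_powS G k') else G.

(* The supremum is taken in \bar R, where it always exists; the (k+1)-st root
   is the real power with exponent 1/(k+1). *)
Definition shannon (R : realType) (T : finType) (G : sgraph T) : \bar R :=
  ereal_sup (range (fun k : nat =>
    (((alpha (strong_powS G k))%:R : R) `^ (k.+1%:R^-1))%:E)).

Section Cones.
Variable R : realType.

Lemma symmetricmxP (n : nat) (Q : 'M[R]_n) :
  reflect (Q^T = Q) (Q \is symmetricmx).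
Proof.
apply: (iffP (is_hermitianmxP _ _ _)); rewrite expr0 scale1r map_mx_id //.
Qed.

Definition copositive (n : nat) : set 'M[R]_n :=
  [set Q | Q \is symmetricmx /\
    forall x : 'cV[R]_n, (forall i, 0 <= x i 0) ->
      0 <= (x^T *m Q *m x) 0 0].

Definition is_cone (n : nat) (A : set 'M[R]_n) : Prop :=
  (forall Q, A Q -> Q \is symmetricmx) /\
  (forall (t : R) (Q : 'M[R]_n), 0 < t -> A Q -> A (t *: Q)).

(* *t is the Kronecker product, rows and columns in lexicographic order. *)
Definition odot (n m : nat) (Q : 'M[R]_n) (P : 'M[R]_m) : 'M[R]_(n * m) :=
  (Q + const_mx 1) *t (P + const_mx 1) - const_mx 1.

Definition product_property (A : forall n : nat, set 'M[R]_n) : Prop :=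
  forall (n m : nat) (Q : 'M[R]_n) (P : 'M[R]_m),
    (0 < n)%N -> (0 < m)%N -> A n Q -> A m P -> A (n * m)%N (odot Q P).

Definition feasible (A : forall n : nat, set 'M[R]_n) (n : nat)
    (G : sgraph 'I_n) (lambda : R) (Y : 'M[R]_n) : Prop :=
  [/\ Y \is symmetricmx,
      A n (Y - const_mx 1),
      forall i, Y i i = lambda
    & forall i j, ~~ adj G i j -> Y i j = 0].

(* An infimum in \bar R: it is +oo when no pair (lambda, Y) is feasible. *)
Definition optval (A : forall n : nat, set 'M[R]_n) (n : nat)
    (G : sgraph 'I_n) : \bar R :=
  ereal_inf [set lambda%:E | lambda in
    [set lambda : R | exists Y : 'M[R]_n, feasible A G lambda Y]].

End Cones.

(* Main.v *)
Require Import Defs.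
From mathcomp Require Import all_boot all_order all_algebra.
From mathcomp Require Import mxtens.
From mathcomp Require Import all_classical all_reals all_analysis.
Import Order.TTheory GRing.Theory Num.Theory.
Local Open Scope classical_set_scope.
Local Open Scope ring_scope.

(** Feasible points behave multiplicatively, while each of them bounds the
independence number of its own graph.

If [W] vanishes at non-adjacent pairs and has constant diagonal [c], then
testing copositivity of [W - J] on the indicator vector of an independent set
[S] leaves only the diagonal of [W], so [0 <= c * #|S| - #|S| ^ 2], that is
[#|S| <= c] ([independent_card_le]).  On the other hand
[(W - J) odot (W' - J) = W *t W' - J], so the product property turns points
feasible for two graphs into one feasible for their strong product, with
value the product of the two values ([bounding_strong_prod]).  Hence a
feasible [lambda] for [G] gives [alpha (G ^ k) <= lambda ^ k] for all [k], and
taking [k]-th roots and then the infimum over [lambda] bounds the Shannon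
capacity. *)

(** The vertices of a strong power form an iterated product type, whereas the
matrices are indexed by ordinals; the map [f] bridges the two.  It may be
arbitrary, since both the quadratic form and the Kronecker product only
involve the entries of [W] at points of its image. *)
Definition bounding {R : realType} (A : forall n : nat, set 'M[R]_n)
    {T : finType} (G : sgraph T) (c : R) : Prop :=
  exists (N : nat) (f : T -> 'I_N) (W : 'M[R]_N),
    [/\ A N (W - const_mx 1),
        forall s, W (f s) (f s) = c
      & forall s t, ~~ adj G s t -> W (f s) (f t) = 0].

Lemma ord_pos {N : nat} (i : 'I_N) : (0 < N)%N.
Proof. by case: N i => // -[]. Qed.

Lemma quad_form_sum_delta {R : realType} (T : finType) (N : nat)
    (f : T -> 'I_N) (S : {set T}) (Q : 'M[R]_N) :
  let x : 'cV[R]_N := \sum_(s in S) delta_mx (f s) 0 in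
  (x^T *m Q *m x) 0 0 = \sum_(s in S) \sum_(t in S) Q (f s) (f t).
Proof.
move=> x; have -> : x^T = \sum_(s in S) delta_mx 0 (f s).
  by rewrite (raddf_sum trmx); apply: eq_bigr => s _; exact: trmx_delta.
rewrite mulmx_suml mulmx_suml summxE.
apply: eq_bigr => s _; rewrite mulmx_sumr summxE.
by apply: eq_bigr => t _; rewrite -rowE -colE !mxE.
Qed.

Lemma independent_card_le {R : realType} {A : forall n : nat, set 'M[R]_n}
    (hcop : forall n : nat, (0 < n)%N -> A n `<=` @copositive R n)
    {T : finType} {G : sgraph T} {c : R} {S : {set T}} (s0 : T) :
  bounding A G c -> s0 \in S -> independent G S -> #|S|%:R <= c.
Proof.
move=> [N [f [W [AW Wdiag W0]]]] s0S indS.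
have [_ cop] := hcop N (ord_pos (f s0)) _ AW.
have := cop (\sum_(s in S) delta_mx (f s) 0).
rewrite quad_form_sum_delta.
have -> : \sum_(s in S) \sum_(t in S) (W - const_mx 1) (f s) (f t)
          = #|S|%:R * (c - #|S|%:R).
  rewrite mulr_natl -sumr_const; apply: eq_bigr => s sS.
  under eq_bigr => t _ do rewrite !mxE.
  rewrite sumrB sumr_const (bigD1 s) //= Wdiag big1 ?addr0 // => t /andP[tS ts].
  apply: W0; rewrite /adj negb_or eq_sym ts /=.
  by move/forall_inP: indS => /(_ s sS) /forall_inP /(_ t tS).
have S_gt0 : 0 < #|S|%:R :> R by rewrite ltr0n; apply/card_gt0P; exists s0.
rewrite pmulr_rge0 // subr_ge0; apply => i.
by rewrite summxE; apply: sumr_ge0 => s _; rewrite mxE ler0n.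
Qed.

Lemma alpha_le {R : realType} {A : forall n : nat, set 'M[R]_n}
    (hcop : forall n : nat, (0 < n)%N -> A n `<=` @copositive R n)
    {T : finType} {G : sgraph T} {c : R} (s0 : T) :
  bounding A G c -> (alpha G)%:R <= c.
Proof.
move=> Bc; have ind1 : independent G [set s0].
  apply/forall_inP => s /set1P ->; apply/forall_inP => t /set1P ->.
  by rewrite (edge_irr G).
rewrite /alpha; elim/big_ind: _ => [|a b ha hb|S indS].
- (* The empty set gives no information on [c]; a singleton does. *)
  by apply: le_trans (independent_card_le hcop s0 Bc (set11 s0) ind1).
- by rewrite /maxn; case: ifP.
case: (set_0Vmem S) => [->|[s sS]]; last exact: independent_card_le Bc sS indS.
rewrite cards0.
by apply: le_trans (independent_card_le hcop s0 Bc (set11 s0) ind1).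
Qed.

Lemma odot_subJ {R : realType} (n m : nat) (W : 'M[R]_n) (V : 'M[R]_m) :
  odot (W - const_mx 1) (V - const_mx 1) = W *t V - const_mx 1.
Proof. by rewrite /odot !subrK. Qed.

(** Non-adjacency in a strong product means non-adjacency in some factor, and
a zero in one factor annihilates the entry of the Kronecker product. *)
Lemma bounding_strong_prod {R : realType} {A : forall n : nat, set 'M[R]_n}
    (hprod : product_property A)
    {T U : finType} {G : sgraph T} {H : sgraph U} {c d : R} (s0 : T) (u0 : U) :
  bounding A G c -> bounding A H d -> bounding A (strong_prod G H) (c * d).
Proof.
move=> [N [f [W [AW Wdiag W0]]]] [M [g [V [AV Vdiag V0]]]].
exists (N * M)%N, (fun p => mxtens_index (f p.1, g p.2)), (W *t V); split.
- rewrite -odot_subJ.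
  by apply: hprod => //; [exact: ord_pos (f s0) | exact: ord_pos (g u0)].
- by move=> p; rewrite tensmxE Wdiag Vdiag.
move=> p q; rewrite adj_strong_prod negb_and tensmxE.
by case/orP => [/W0 ->|/V0 ->]; rewrite ?mul0r ?mulr0.
Qed.

Lemma powS_point {T : finType} (s0 : T) (k : nat) : powS_vertex T k.
Proof. by elim: k => [|k u] //=; exact: (s0, u). Qed.

Lemma bounding_strong_powS {R : realType} {A : forall n : nat, set 'M[R]_n}
    (hprod : product_property A)
    {T : finType} {G : sgraph T} {c : R} (s0 : T) (k : nat) :
  bounding A G c -> bounding A (strong_powS G k) (c ^+ k.+1).
Proof.
move=> Bc; elim: k => [|k IHk]; first by rewrite expr1.
by rewrite exprS; apply: bounding_strong_prod (powS_point s0 k) _ IHk.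
Qed.

Theorem theorem3 (R : realType) (A : forall n : nat, set 'M[R]_n)
  (hcone : forall n : nat, (0 < n)%N -> is_cone (A n))
  (hcop : forall n : nat, (0 < n)%N -> A n `<=` @copositive R n)
  (hprod : product_property A)
  (n : nat) (hn : (0 < n)%N) (G : sgraph 'I_n) :
  (shannon R G <= optval A G)%E.
Proof.
apply: le_ereal_inf_tmp => _ [lambda [Y [_ AY Ydiag Y0]] <-].
apply: ge_ereal_sup => _ [k _ <-]; rewrite lee_fin.
have Bl : bounding A G lambda by exists n, id, Y.
pose s0 := Ordinal hn.
have l_ge0 : 0 <= lambda := le_trans (ler0n _ _) (alpha_le hcop s0 Bl).
have root_pow : (lambda ^+ k.+1) `^ (k.+1%:R^-1) = lambda.
  by rewrite -powR_mulrn // -powRrM mulfV ?pnatr_eq0 // powRr1.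
rewrite -[leRHS]root_pow ge0_ler_powR ?invr_ge0 ?nnegrE ?ler0n ?exprn_ge0 //.
exact: (alpha_le hcop (powS_point s0 k) (bounding_strong_powS hprod s0 k Bl)).
Qed.
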